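(* Let $r,m\in\mathbb N$ and let $\mathbb N=\bigcup_{i=1}^r E_i$. Suppose that for each $i\in\{1,2,\dots,m\}$, $A_i$ is a $u_i\times v_i$ image partition regular matrix over $(\mathbb N,+)$ with rational entries, where $u_i,v_i\in\mathbb N$. Then there exist $k\in\{1,2,\dots,r\}$, vectors $\vec{x}^{(i)},\vec{y}^{(i)}\in\mathbb N^{v_i}$ for $i\in\{1,2,\dots,m\}$, and a sequence $\{z_t\}_{t=1}^\infty$ in $\mathbb N$ such that $A_i\vec{x}^{(i)}\in E_k^{u_i}$ for each $i\in\{1,2,\dots,m\}$, $P(A_1\vec{y}^{(1)},A_2\vec{y}^{(2)},\dots,A_m\vec{y}^{(m)})\subseteq E_k$, and $PS_m(\{z_t\}_{t=1}^\infty)\subseteq E_k$.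
   Context: $\mathbb N=\{1,2,3,\dots\}$; $\mathcal P_f(\mathbb N)$ is the set of finite nonempty subsets of $\mathbb N$. A matrix $A$ with rational entries is image partition regular (over $(\mathbb N,+)$) if whenever $\mathbb N$ is finitely colored there is a vector $\vec x$ with entries from $\mathbb N$ such that all entries of $A\vec x$ lie in one color class. For vectors $\vec w^{(1)},\dots,\vec w^{(m)}$ with entries from $\mathbb N$, $P(\vec w^{(1)},\dots,\vec w^{(m)})=\{\prod_{i=1}^m w_i: w_i \text{ is an entry of } \vec w^{(i)} \text{ for each } i=1,\dots,m\}$. For a sequence $\{z_t\}_{t=1}^\infty$ in $\mathbb N$, $PS_m(\{z_t\}_{t=1}^\infty)=\{\prod_{i=1}^m\sum_{t\in F_i}z_t: F_1,\dots,F_m\in\mathcal P_f(\mathbb N)\text{ and }\max F_i<\min F_{i+1}\text{ for all } i=1,\dots,m-1\}$. *)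

(* Defs.v *)
From HB Require Import structures.
From mathcomp Require Import all_boot all_order all_algebra finmap.
From mathcomp Require Import boolp classical_sets.
Set Implicit Arguments.
Unset Strict Implicit.
Unset Printing Implicit Defensive.
Import GRing.Theory.
Local Open Scope classical_set_scope.
Local Open Scope ring_scope.

(* The natural numbers of the statement are {1, 2, 3, ...}; subsets of it are
   encoded as sets of [nat] not containing 0. *)
Definition Npos : set nat := [set n | (0 < n)%N].

Definition inQ (S : set nat) : set rat := [set n%:R | n in S].

(* [vec_in S w] is "w belongs to S^p". *)
Definition vec_in (T : Type) (p : nat) (S : set T) (w : 'cV[T]_p) : Prop :=
  forall j : 'I_p, S (w j 0).

Definition ratv (p : nat) (x : 'cV[nat]_p) : 'cV[rat]_p :=
  map_mx (fun n : nat => n%:R) x.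

(* A finite coloring is a map into some 'I_r; its value at 0 plays no role. *)
Definition image_partition_regular (p q : nat) (A : 'M[rat]_(p, q)) : Prop :=
  forall (r : nat) (c : nat -> 'I_r),
  exists x : 'cV[nat]_q, vec_in Npos x /\
  exists k : 'I_r, vec_in (inQ [set n | Npos n /\ c n = k]) (A *m ratv x).

(* Defined for rational vectors, so that it applies to the vectors A_i y^(i);
   that these have entries in [Npos] has to be required separately. *)
Definition prod_set (m : nat) (u : 'I_m -> nat)
    (w : forall i : 'I_m, 'cV[rat]_(u i)) : set rat :=
  [set a | exists j : forall i : 'I_m, 'I_(u i),
     a = \prod_(i < m) w i (j i) 0].

Definition Pf : set {fset nat} :=
  [set F | F != fset0 /\ forall t : nat, t \in F -> Npos t].

(* The sets F_1, ..., F_m are indexed by 'I_m, i.e. from 0; for nonempty finite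
   sets, max F < min G says that every element of F is below every one of G. *)
Definition PS (m : nat) (z : nat -> nat) : set nat :=
  [set a | exists F : 'I_m -> {fset nat},
     [/\ forall i, Pf (F i),
         forall i j : 'I_m, j = i.+1 :> nat ->
           forall s t : nat, s \in F i -> t \in F j -> (s < t)%N
       & a = (\prod_(i < m) \sum_(t <- F i) z t)%N]].

(* Main.v *)
(** Say that a set of positive integers is rich when it contains an image of
    each A_i. There is an ultrafilter on {1, 2, ...} all of whose members are
    rich: for a single matrix this is image partition regularity, and the
    multiplicative convolution of ultrafilters that work for different matrices
    works for all of them. Such ultrafilters form a closed subsemigroup for
    additive convolution, because A(x + y) = Ax + Ay, so by the Ellis-Numakura
    lemma one of them, p, satisfies p + p = p. The color E_k is the one that
    belongs to the m-fold multiplicative power of p: it contains multiples of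
    members of p, hence images of the A_i; it contains the products because all
    members of p contain images of the A_i; and the sequence z is built
    by the Galvin-Glazer construction from p + p = p. *)
Require Import Defs.
From mathcomp Require Import all_boot all_order all_algebra finmap.
From mathcomp Require Import boolp classical_sets filter.
Set Implicit Arguments.
Unset Strict Implicit.
Unset Printing Implicit Defensive.
Import GRing.Theory.
Local Open Scope classical_set_scope.
Local Open Scope ring_scope.

(** * Ultrafilters and the Ellis-Numakura lemma *)

Lemma ultra_setC T (p : set_system T) (S : set T) :
  UltraFilter p -> p (~` S) <-> ~ p S.
Proof.
move=> pU; split=> [pC pS|]; last by case: (in_ultra_setVsetC S pU).
by have /filter_ex [x []] : p (S `&` ~` S) by exact: filterI.
Qed.

Lemma proper_setVsetC_ultra T (p : set_system T) :
  ProperFilter p -> (forall S, p S \/ p (~` S)) -> UltraFilter p.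
Proof.
move=> pP pC; split=> // G GP pG; apply/seteqP; split=> // S GS.
have [//|/pG GC] := pC S.
by have /filter_ex [x []] : G (S `&` ~` S) by exact: filterI.
Qed.

Lemma ultra_sub_eq T (p q : set_system T) :
  UltraFilter p -> UltraFilter q -> p `<=` q -> p = q.
Proof. by move=> pU qU pq; rewrite (@max_filter _ _ pU q). Qed.

Lemma ultra_exists_ord T (p : set_system T) r (E : 'I_r -> set T) :
  UltraFilter p -> p (\bigcup_k E k) -> exists k, p (E k).
Proof.
move=> pU pE; apply: contrapT => /forallNP nE.
have pC : p [set x | forall k, ~ E k x].
  by apply: filter_forall => k; apply/ultra_setC.
have /filter_ex [x [[k _ Ekx] /(_ k)]//] :
    p ((\bigcup_k E k) `&` [set x | forall k, ~ E k x]) by exact: filterI.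
Qed.

(** On ultrafilters this is the extension of [op] to the Stone-Cech compactification that is
    continuous in [p] for fixed [q]. *)
Definition convolution T (op : T -> T -> T) (p q : set_system T) :
  set_system T := [set S | p [set a | q [set b | S (op a b)]]].

Lemma convolution_ultra T (op : T -> T -> T) (p q : set_system T) :
  UltraFilter p -> UltraFilter q -> UltraFilter (convolution op p q).
Proof.
move=> pU qU; have ? : ProperFilter (convolution op p q).
  split; last split.
  - by move=> /(@filter_ex _ p) [a /(@filter_ex _ q) [b]].
  - by apply: (@filterE _ p) => a; apply: filterE.
  - by move=> S S'; apply: (@filterS2 _ p) => a; apply: (@filterI _ q).
  - by move=> S S' SS'; apply: (@filterS _ p) => a; apply: filterS => b /SS'.
apply: proper_setVsetC_ultra => S.
have [?|pC] := in_ultra_setVsetC [set a | q [set b | S (op a b)]] pU.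
  by left.
by right; apply: (@filterS _ p) pC => a qS; apply/(@ultra_setC _ q).
Qed.

Lemma convolutionA T (op : T -> T -> T) : associative op ->
  associative (convolution op).
Proof.
move=> opA p q s; apply/funext => S; rewrite /convolution /=.
congr p; apply/funext => a /=; congr q; apply/funext => b /=.
by congr s; apply/funext => c /=; rewrite opA.
Qed.

(* The closed sets of the Stone-Cech compactification of [T] are those of the
   form [ultra_above F]. *)
Definition ultra_above T (F : set_system T) : set (set_system T) :=
  [set p | UltraFilter p /\ F `<=` p].

Section EllisNumakura.
Variables (T : Type) (op : T -> T -> T).
Hypothesis opA : associative op.

Definition subsemigroup (K : set (set_system T)) :=
  K !=set0 /\ forall p q, K p -> K q -> K (convolution op p q).

(** Compactness for chains: the sets common to all ultrafilters above some [F] in [A] form a proper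
    filter, and any ultrafilter extending it lies above the union. *)
Lemma ultra_above_bigcup (A : set (set_system T)) :
  A !=set0 -> total_on A subset -> (forall F, A F -> ultra_above F !=set0) ->
  ultra_above (\bigcup_(F in A) F) !=set0.
Proof.
move=> [F0 AF0] Atot A0.
pose G := [set S | exists2 F, A F & forall p, ultra_above F p -> p S].
have GP : ProperFilter G.
  split; last split.
  - move=> [F AF FS]; have [p Fp] := A0 _ AF; have [pU _] := Fp.
    exact: filter_not_empty (FS _ Fp).
  - by exists F0 => // p [pU _]; apply: filterT.
  - move=> S S' [F AF FS] [F' AF' FS'].
    wlog FF' : S S' F F' AF FS AF' FS' / F `<=` F' => [th|].
      have [/th|/th] := Atot _ _ AF AF'; first exact.
      by rewrite setIC; apply.
    exists F' => // p F'p; have [pU F'sub] := F'p.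
    apply: filterI; last exact: FS'.
    by apply: FS; split=> //; apply: subset_trans F'sub.
  - move=> S S' SS' [F AF FS]; exists F => // p Fp; have [pU _] := Fp.
    exact: filterS SS' (FS _ Fp).
have [p [pU Gp]] := ultraFilterLemma GP.
exists p; split=> // S [F AF FS]; apply: Gp; exists F => // q [_]; exact.
Qed.

(* Right translates of closed sets of ultrafilters are closed; this is where
   compactness is used. *)
Lemma ultra_above_convolutionr (F : set_system T) (p : set_system T) :
  UltraFilter p ->
  ultra_above [set S | forall q, ultra_above F q -> convolution op q p S] `<=`
  [set convolution op q p | q in ultra_above F].
Proof.
move=> pU s [sU Fs].
pose star S := [set a | p [set b | S (op a b)]].
pose G := [set U | exists V S, [/\ forall q, ultra_above F q -> q V, s S
  & V `&` star S `<=` U]].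
have GP : ProperFilter G.
  split; last split.
  - move=> [V [S [FV sS VS]]].
    have /Fs /ultra_setC : [set S' | forall q, ultra_above F q ->
        convolution op q p S'] (~` S).
      move=> q Fq; have [qU _] := Fq; apply: filterS (FV q Fq) => a Va.
      by apply/ultra_setC => Sa; case: (VS a).
    exact.
  - exists setT, setT; split=> //; first by move=> q [qU _]; apply: filterT.
    exact: filterT.
  - move=> U U' [V [S [FV sS VS]]] [V' [S' [FV' sS' VS']]].
    exists (V `&` V'), (S `&` S'); split; last 2 first.
    + exact: filterI.
    + move=> a [[Va V'a] Sa]; split; [apply: VS|apply: VS']; split=> //.
        by apply: filterS Sa => b [].
      by apply: filterS Sa => b [].
    + by move=> q Fq; have [qU _] := Fq; apply: filterI; [apply: FV|apply: FV'].
  - move=> U U' UU' [V [S [FV sS VS]]]; exists V, S; split=> //.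
    exact: subset_trans UU'.
have [q [qU Gq]] := ultraFilterLemma GP.
exists q.
  split=> // S FS; apply: Gq; exists S, setT.
  by split; [move=> ? [_]; apply|exact: (@filterT _ s)|move=> ? []].
apply/esym/ultra_sub_eq => //; first exact: convolution_ultra.
move=> S sS; apply: Gq; exists setT, S; split; [|exact: sS|by move=> ? []].
by move=> ? [? _]; apply: filterT.
Qed.

(** Enlarging [F] shrinks the closed set above it, so a maximal [F] gives a minimal closed
    subsemigroup [K]. Any [p] in [K] is then idempotent. *)
Lemma exists_idempotent_ultra (F0 : set_system T) :
  subsemigroup (ultra_above F0) ->
  exists2 p, ultra_above F0 p & convolution op p p = p.
Proof.
move=> F0s.
(* Keeping [F0] apart from [F] lets the empty chain, whose union is empty, stand for the given
   subsemigroup. *)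
pose P F := subsemigroup (ultra_above (F0 `|` F)).
have [|F [FP Fmax]] := @Zorn_bigcup _ P.
  move=> A AP Atot; have [->|/set0P [F AF]] := eqVneq A set0.
    by rewrite /P bigcup_set0 setU0.
  have aboveE p : ultra_above (F0 `|` \bigcup_(X in A) X) p <->
      forall X, A X -> ultra_above (F0 `|` X) p.
    split=> [[pU sp] X AX|Xp].
      by split=> // S [F0S|XS]; apply: sp; [left|right; exists X].
    have [pU Fp] := Xp _ AF; split=> // S [F0S|[X AX XS]].
      by apply: Fp; left.
    by have [_ XXp] := Xp _ AX; apply: XXp; right.
  split; last first.
    move=> p q /aboveE Ap /aboveE Aq; apply/aboveE => X AX.
    by apply: (AP _ AX).2; [apply: Ap|apply: Aq].
  have [||X [Y AY <-]|p [pU Ap]] :=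
      @ultra_above_bigcup [set F0 `|` X | X in A].
  - by exists (F0 `|` F); exists F.
  - move=> _ _ [X AX <-] [Y AY <-].
    by have [XY|YX] := Atot _ _ AX AY; [left|right]; apply: setUS.
  - exact: (AP _ AY).1.
  - exists p; apply/aboveE => X AX; split=> // S XS; apply: Ap.
    by exists (F0 `|` X) => //; exists X.
have maxE F' : F `<=` F' -> P F' -> F' `<=` F.
  by move=> FF' PF'; apply: contrapT => nF'F; apply: (Fmax F').
set K := ultra_above (F0 `|` F) in FP.
have [[p Kp] Ksg] := FP; have [pU Fp] := Kp.
have convU q : K q -> UltraFilter (convolution op q p).
  by move=> [qU _]; apply: convolution_ultra.
(* [F1] cuts out the left ideal of products of elements of [K] with [p]; by minimality it is all of
   [K], so [p] itself is such a product. *)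
pose F1 := [set S | forall q, K q -> convolution op q p S].
have FF1 : F0 `|` F `<=` F1.
  by move=> S FS q Kq; have [_] := Ksg _ _ Kq Kp; apply.
have F1K : ultra_above (F0 `|` F1) = [set convolution op q p | q in K].
  have -> : F0 `|` F1 = F1.
    by apply/setUidPr => S F0S; apply: FF1; left.
  apply/seteqP; split=> [|_ [q Kq <-]]; first exact: ultra_above_convolutionr.
  by split=> [|S]; [apply: convU|apply].
have F1F : F1 `<=` F.
  apply: maxE => [S FS|]; first by apply: FF1; right.
  rewrite /P F1K; split; first by exists (convolution op p p); exists p.
  move=> _ _ [q Kq <-] [q' Kq' <-].
  exists (convolution op (convolution op q p) q').
    exact: (Ksg _ _ (Ksg _ _ Kq Kp)).
  by rewrite !convolutionA.
have [q0 Kq0 q0p] : [set convolution op q p | q in K] p.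
  by rewrite -F1K; split=> // S [F0S|/F1F FS]; apply: Fp; [left|right].
(* [F2] cuts out the [q] in [K] whose product with [p] is [p]; by minimality again these include
   [p]. *)
pose F2 := F `|` [set [set a | p [set b | S (op a b)]] | S in p].
have F2K q : ultra_above (F0 `|` F2) q <-> K q /\ convolution op q p = p.
  split=> [[qU sq]|[[qU Kq] qp]].
    have Kq : K q.
      by split=> // S [F0S|FS]; apply: sq; [left|right; left].
    split=> //; apply/esym/ultra_sub_eq => //; first exact: convU.
    by move=> S pS; apply: sq; right; right; exists S.
  split=> // S [F0S|[FS|[S' pS' <-]]].
  - by apply: Kq; left.
  - by apply: Kq; right.
  - by move: pS'; rewrite -{1}qp.
have F2F : F2 `<=` F.
  apply: maxE => [S FS|]; first by left.
  split; first by exists q0; apply/F2K.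
  move=> q q' /F2K [Kq qp] /F2K [Kq' q'p]; apply/F2K; split; first exact: Ksg.
  by rewrite -convolutionA // q'p.
have [_ pp] : K p /\ convolution op p p = p.
  by apply/F2K; split=> // S [F0S|/F2F FS]; apply: Fp; [left|right].
by exists p => //; split=> // S F0S; apply: Fp; left.
Qed.

End EllisNumakura.

(** * Sets containing an image of a matrix *)

Definition rich p q (A : 'M[rat]_(p, q)) (S : set nat) : Prop :=
  exists (x : 'cV[nat]_q) (w : 'cV[nat]_p),
    [/\ vec_in Npos x, A *m ratv x = ratv w & vec_in S w].

Lemma ratvD p (x y : 'cV[nat]_p) : ratv (x + y) = ratv x + ratv y.
Proof. by apply/matrixP => i j; rewrite !mxE natrD. Qed.

Lemma ratvMn p (x : 'cV[nat]_p) n : ratv (x *+ n) = ratv x *+ n.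
Proof.
elim: n => [|n IH]; last by rewrite !mulrS ratvD IH.
by apply/matrixP => i j; rewrite !mxE.
Qed.

Lemma mulrn_cVE p (x : 'cV[nat]_p) n i j : (x *+ n) i j = (x i j * n)%N.
Proof. by rewrite mulmxnE -mulr_natr natn. Qed.

Lemma richS p q (A : 'M[rat]_(p, q)) S S' : S `<=` S' -> rich A S -> rich A S'.
Proof.
by move=> SS' [x [w [xN Ax wS]]]; exists x, w; split=> // j; apply: SS'.
Qed.

Lemma rich_nonempty p q (A : 'M[rat]_(p, q)) S :
  (0 < p)%N -> rich A S -> S !=set0.
Proof.
by case: p A => // p A _ [x [w [_ _ wS]]]; exists (w 0 0); apply: wS.
Qed.

Lemma rich_mul p q (A : 'M[rat]_(p, q)) S a :
  (0 < a)%N -> rich A [set b | S (a * b)%N] -> rich A S.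
Proof.
move=> a_gt0 [x [w [xN Ax wS]]]; exists (x *+ a), (w *+ a); split.
- by move=> j; rewrite /Npos /= mulrn_cVE muln_gt0 a_gt0 andbT; apply: xN.
- by rewrite !ratvMn -Ax (raddfMn (mulmx A)).
- by move=> j; rewrite mulrn_cVE mulnC; apply: wS.
Qed.

Lemma image_partition_regular_rich p q (A : 'M[rat]_(p, q)) (C : finType)
    (c : nat -> C) : image_partition_regular A ->
  exists k, rich A [set n | Npos n /\ c n = k].
Proof.
move=> /(_ _ (enum_rank \o c)) [x [xN [k Ak]]].
have /choice[w wP] j : exists n, (Npos n /\ c n = enum_val k) /\
    (A *m ratv x) j 0 = n%:R.
  have [n [nN /= nk] <-] := Ak j; exists n; split=> //; split=> //.
  by rewrite -nk enum_rankK.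
exists (enum_val k), x, (\col_j w j); split=> //.
  by apply/matrixP => i j; rewrite ord1 (wP i).2 !mxE.
by move=> j; rewrite mxE; apply: (wP j).1.
Qed.

(** A finite coloring determines the union of its rich classes, which is nonempty by regularity.
    Product colorings show that these unions generate a proper filter, which extends to an
    ultrafilter. *)
Lemma exists_rich_ultra p q (A : 'M[rat]_(p, q)) :
  (0 < p)%N -> image_partition_regular A ->
  exists U, [/\ UltraFilter U, U Npos & forall S, U S -> rich A S].
Proof.
move=> p_gt0 Areg.
pose G := [set S | exists (C : finType) (c : nat -> C), forall k,
  rich A [set n | Npos n /\ c n = k] -> [set n | Npos n /\ c n = k] `<=` S].
have GP : ProperFilter G.
  split; last split.
  - move=> [C [c cG]].
    have [k kA] := image_partition_regular_rich c Areg.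
    by have [n /(cG _ kA)] := rich_nonempty p_gt0 kA.
  - by exists unit, (fun=> tt).
  - move=> S S' [C [c cS]] [C' [c' cS']].
    exists (C * C')%type, (fun n => (c n, c' n)) => -[k k'] kA n [nN [cn c'n]].
    split; [apply: (cS k)|apply: (cS' k')] => //;
      apply: richS kA => {cn c'n nN n}.
      by move=> n [nN [cn _]].
    by move=> n [nN [_ cn]].
  - by move=> S S' SS' [C [c cS]]; exists C, c => k /cS cSk n /cSk /SS'.
have [U [UU GU]] := ultraFilterLemma GP.
exists U; split=> //; first by apply: GU; exists unit, (fun=> tt) => k _ n [].
move=> S US; apply: contrapT => nS.
suff /GU /ultra_setC : G (~` S) by [].
(* If [S] is not rich, only the class off [S] can be rich in the coloring by membership in [S]. *)
exists bool, (fun n => `[< S n >]) => -[] kA n [nN].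
  by case: nS; apply: richS kA => {nN n} n [nN /asboolP].
by move=> /asboolP.
Qed.

Lemma exists_rich_family_ultra (I : eqType) (u v : I -> nat)
    (A : forall i, 'M[rat]_(u i, v i)) (s : seq I) :
  (forall i, 0 < u i)%N -> (forall i, image_partition_regular (A i)) ->
  exists U, [/\ UltraFilter U, U Npos &
    forall i S, i \in s -> U S -> rich (A i) S].
Proof.
move=> u_gt0 Areg; elim: s => [|i s [U [UU UN Us]]].
  exists (principal_filter 1%N); split=> //.
    exact: principal_filter_ultra.
  exact/principal_filterP.
have [V [VU VN Vi]] := exists_rich_ultra (u_gt0 i) (Areg i).
exists (convolution muln V U); split; first exact: convolution_ultra.
  apply: filterS VN => a aN; apply: filterS UN => b bN.
  by rewrite /Npos /= muln_gt0; apply/andP.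
move=> j S; rewrite inE => /orP[/eqP ->{j}|js] VUS.
  (* An image has finitely many entries, so one [b] multiplies all of them into [S]. *)
  have [x [w [xN Ax wS]]] := Vi _ VUS.
  have /filter_ex [b [bN bw]] :
      U (Npos `&` [set b | forall j, S (w j 0%R * b)%N]).
    by apply: filterI => //; apply: filter_forall.
  apply: (@rich_mul _ _ _ _ b) => //; exists x, w; split=> // j.
  by rewrite /= mulnC; apply: bw.
have /filter_ex [a [aN Ua]] : V (Npos `&` [set a | U [set b | S (a * b)%N]]).
  exact: filterI.
by apply: (rich_mul aN); apply: Us.
Qed.

Lemma exists_rich_idempotent (I : finType) (u v : I -> nat)
    (A : forall i, 'M[rat]_(u i, v i)) :
  (forall i, 0 < u i)%N -> (forall i, image_partition_regular (A i)) ->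
  exists p, [/\ UltraFilter p, p Npos, forall i S, p S -> rich (A i) S &
    convolution addn p p = p].
Proof.
move=> u_gt0 Areg.
(* All members of an ultrafilter are rich exactly when it contains the complement of every set that
   is not rich; this makes the condition closed. *)
pose F0 := [set S | S = Npos \/ exists i, ~ rich (A i) (~` S)].
have F0P p : ultra_above F0 p <->
    [/\ UltraFilter p, p Npos & forall i S, p S -> rich (A i) S].
  split=> [[pU F0p]|[pU pN pA]]; split=> //.
  - by apply: F0p; left.
  - move=> i S pS; apply: contrapT => nS.
    suff /F0p /ultra_setC : F0 (~` S) by [].
    by right; exists i; rewrite setCK.
  - move=> S [->//|[i nS]]; have [//|pS] := in_ultra_setVsetC S pU.
    by case: nS; apply: pA.
have [|p /F0P [pU pN pA] pp] := @exists_idempotent_ultra _ addn addnA F0.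
- split.
    have [p [pU pN pA]] := exists_rich_family_ultra (enum I) u_gt0 Areg.
    by exists p; apply/F0P; split=> // i S; apply: pA; rewrite mem_enum.
  move=> p q /F0P [pU pN pA] /F0P [qU qN qA]; apply/F0P; split.
  + exact: convolution_ultra.
  + apply: filterS pN => a aN; apply: filterS qN => b bN.
    by rewrite /Npos /= addn_gt0; apply/orP; left.
  + move=> i S /(pA i) [x [w [xN Ax wS]]].
    have /(qA i) [x' [w' [xN' Ax' wS']]] :
        q [set b | forall j, S (w j 0%R + b)%N] by exact: filter_forall.
    exists (x + x'), (w + w'); split.
    * by move=> j; rewrite /Npos /= mxE addn_gt0 xN.
    * by rewrite !ratvD mulmxDr Ax Ax'.
    * by move=> j; rewrite mxE; apply: wS'.
- by exists p.
Qed.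

(** * Multiplicative powers of an idempotent *)

Lemma filter_all_seq (I : eqType) T (p : set_system T) (s : seq I)
    (f : I -> set T) :
  Filter p -> (forall i, i \in s -> p (f i)) ->
  p [set x | forall i, i \in s -> f i x].
Proof.
move=> pF; elim: s => [|i s IH] pf; first exact: filterE.
have := IH (fun j js => pf j (mem_behead (s := i :: s) js)).
apply: filterS2 (pf i (mem_head i s)) => x fx sx j.
by rewrite inE => /predU1P[->|/sx].
Qed.

(* [E] belongs to the [l]-th multiplicative power of [p], translated by [a]. *)
Fixpoint in_power (p : set_system nat) (E : set nat) l a : Prop :=
  if l is l'.+1 then p [set b | in_power p E l' (a * b)%N] else E a.

Lemma in_power_cover (p : set_system nat) r (E : 'I_r -> set nat) l a :
  UltraFilter p -> p Npos -> Npos `<=` \bigcup_k E k -> Npos a ->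
  exists k, in_power p (E k) l a.
Proof.
move=> pU pN NE; elim: l a => [|l IH] a aN.
  by have [k _ Ek] := NE a aN; exists k.
apply: (@ultra_exists_ord _ p _ (fun k =>
  [set b | in_power p (E k) l (a * b)%N])).
apply: filterS pN => b bN.
by have [|k] := IH (a * b)%N; [rewrite /Npos /= muln_gt0; apply/andP|exists k].
Qed.

(** The last factor ranges over a member of [p], which contains an image of [A]; the earlier
    factors, once fixed, only scale it. *)
Lemma in_power_rich (p : set_system nat) u v (A : 'M[rat]_(u, v)) E l a :
  ProperFilter p -> p Npos -> (forall S, p S -> rich A S) -> Npos a ->
  in_power p E l.+1 a -> rich A E.
Proof.
move=> pP pN pA; elim: l a => [|l IH] a aN pE.
  exact: (rich_mul aN (pA _ pE)).
have /filter_ex [b [bN]] : p (Npos `&` [set b | in_power p E l.+1 (a * b)%N]).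
  exact: filterI.
by apply: IH; rewrite /Npos /= muln_gt0; apply/andP.
Qed.

(** The images are chosen one index at a time. The finitely many products of entries chosen so far
    each leave a member of [p] for the next factor, and the intersection of these members contains
    an image of the next matrix. *)
Lemma in_power_images (p : set_system nat) m (u v : 'I_m -> nat)
    (A : forall i, 'M[rat]_(u i, v i)) E :
  ProperFilter p -> p Npos -> (forall i S, p S -> rich (A i) S) ->
  in_power p E m 1 ->
  exists (y : forall i, 'cV[nat]_(v i)) (w : forall i, 'cV[nat]_(u i)),
    [/\ forall i, vec_in Npos (y i), forall i, vec_in Npos (w i),
        forall i, A i *m ratv (y i) = ratv (w i)
      & forall j : (forall i, 'I_(u i)), E (\prod_(i < m) w i (j i) 0%R)%N].
Proof.
move=> pP pN pA Em.
suff /(_ m (leqnn m)) [y [w [yN wN yw wE]]] : forall k, (k <= m)%N ->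
    exists (y : forall i, 'cV[nat]_(v i)) (w : forall i, 'cV[nat]_(u i)),
    [/\ forall i, vec_in Npos (y i), forall i, vec_in Npos (w i),
        forall i, A i *m ratv (y i) = ratv (w i)
      & forall j : (forall i, 'I_(u i)),
          in_power p E (m - k) (\prod_(i < m | (i < k)%N) w i (j i) 0%R)%N].
  exists y, w; split=> // j; have := wE j; rewrite subnn /=.
  by under eq_bigl do rewrite ltn_ord.
elim=> [_|k IH km].
  (* Arbitrary positive images serve as initial values; each is replaced when its index is
     reached. *)
  have yw i : exists yw : 'cV[nat]_(v i) * 'cV[nat]_(u i),
      [/\ vec_in Npos yw.1, vec_in Npos yw.2 & A i *m ratv yw.1 = ratv yw.2].
    by have [y [w [yN Ay wN]]] := pA i _ pN; exists (y, w).
  have {yw}yw i := cid (yw i).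
  exists (fun i => (sval (yw i)).1), (fun i => (sval (yw i)).2).
  split; try by move=> i; case: (svalP (yw i)).
  by move=> j; rewrite subn0 big_pred0.
have [y [w [yN wN yw wE]]] := IH (ltnW km).
pose i0 := Ordinal km.
(* The choice functions are taken in a [dffun] type, which is finite, so that the intersection stays
   in [p]. *)
have : p [set b | Npos b /\ forall j : {dffun forall i, 'I_(u i)},
    in_power p E (m - k.+1) (\prod_(i < m | (i < k)%N) w i (j i) 0%R * b)%N].
  apply: filterI => //; apply: filter_forall => j.
  by have := wE j; rewrite -(subnSK km).
move=> /(pA i0) [y0 [w0 [y0N Ay0 w0E]]].
exists (dfwith y y0), (dfwith w w0); split.
- by move=> i; case: dfwithP.
- move=> i; case: dfwithP => [j|i' _]; [exact: (w0E j).1|exact: wN].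
- move=> i; have [<-|i0i] := eqVneq i0 i; first by rewrite !dfwith_in.
  by rewrite !dfwith_out.
- move=> j; rewrite (bigD1 i0) //= dfwith_in mulnC.
  have := (w0E (j i0)).2 [ffun i => j i].
  congr in_power; congr (_ * _)%N; apply: eq_big => [i|i].
    by rewrite ltnS ltn_neqAle andbC.
  by move=> ik; rewrite ffunE dfwith_out // neq_ltn ik orbT.
Qed.

(** * The Galvin-Glazer construction of the sequence *)

Lemma exists_filter_sequence (X : eqType) (G : X -> Prop)
    (step : X -> nat -> seq X) (p : set_system nat) x0 :
  ProperFilter p -> p Npos -> G x0 ->
  (forall x, G x -> p [set z | forall x', x' \in step x z -> G x']) ->
  exists (z : nat -> nat) (L : nat -> seq X),
    [/\ L 0%N = [:: x0],
        forall n, L n.+1 = flatten [seq step x (z n.+1) | x <- L n],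
        forall n, Npos (z n) & forall n x, x \in L n -> G x].
Proof.
move=> pP pN Gx0 stepG.
(* [L n] lists the finitely many states reachable after [n] steps. While they are all good,
   [Z (L n)] is in [p], so [xget] returns an element of it and not the default. *)
pose Z (L : seq X) := [set z | Npos z /\
  forall x, x \in L -> forall x', x' \in step x z -> G x'].
have ZP L : (forall x, x \in L -> G x) -> Z L (xget 1%N (Z L)).
  move=> LG; apply: xgetPex; apply: (@filter_ex _ p).
  by apply: filterI => //; apply: filter_all_seq => x /LG /stepG.
pose L n := iter n
  (fun L => flatten [seq step x (xget 1%N (Z L)) | x <- L]) [:: x0].
have LG n x : x \in L n -> G x.
  elim: n x => [|n IH] x; first by rewrite inE => /eqP ->.
  by move=> /flatten_mapP [x' x'L]; apply: (ZP _ IH).2.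
exists (fun n => xget 1%N (Z (L n.-1))), L; split=> // n.
exact: (ZP _ (@LG n.-1)).1.
Qed.

(* A state [(l, a, s)] of the construction of [z] records the product [a] of
   the closed blocks, the sum [s] of the current block, and the number [l] of
   blocks that are not closed yet, the current one included. *)
Definition good_state (p : set_system nat) E (x : nat * nat * nat) : Prop :=
  let: (l, a, s) := x in
  if l is l'.+1 then p [set b | in_power p E l' (a * (s + b))%N] else E a.

(** The options are to skip [z], to add it to the current block, or to add it and close the
    block. *)
Definition next_states (x : nat * nat * nat) (z : nat) :=
  let: (l, a, s) := x in
  if l is l'.+1 then [:: x; (l, a, s + z)%N; (l', a * (s + z), 0)%N]
  else [:: x].

(** Goodness itself handles closing the block with [z]; rewriting [p] as [p + p] shows that for
    [p]-many [z] the block can also be continued after [z]. *)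
Lemma good_next_states (p : set_system nat) E x :
  Filter p -> convolution addn p p = p -> good_state p E x ->
  p [set z | forall x', x' \in next_states x z -> good_state p E x'].
Proof.
case: x => [[[|l] a] s] pF pp Ex /=.
  by apply: filterE => z x'; rewrite inE => /eqP ->.
have := Ex; rewrite /= -{1}pp; apply: filterS2 (Ex) => z Ez Ezb x'.
rewrite !inE => /or3P [] /eqP -> //=.
  by apply: filterS Ezb => b; rewrite /= addnA.
by case: l Ez {Ex Ezb} => [|l].
Qed.

Lemma fset_nat_max (F : {fset nat}) :
  F != fset0 -> exists2 k, k \in F & forall t, t \in F -> (t <= k)%N.
Proof.
move=> /fset0Pn F0.
have Fle t : t \in F -> (t <= \max_(s <- F) s)%N.
  by move=> tF; apply: leq_bigmax_seq.
by have [k kF kmax] := ex_maxnP F0 Fle; exists k.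
Qed.

(** Each choice of [F] is a path through the states: add [z t] for [t] in the current set, skip the
    other [t], and close the block at its maximum. *)
Lemma in_power_PS (p : set_system nat) E m :
  ProperFilter p -> p Npos -> convolution addn p p = p -> in_power p E m 1 ->
  exists2 z : nat -> nat, forall t, Npos (z t) & PS m z `<=` E.
Proof.
move=> pP pN pp Em.
have Gm : good_state p E (m, 1%N, 0%N) by case: m Em.
have [z [L [L0 LS zN LG]]] := exists_filter_sequence pP pN Gm
  (fun x => good_next_states (E := E) (x := x) _ pp).
have Lstep n x x' : x \in L n -> x' \in next_states x (z n.+1) -> x' \in L n.+1.
  by move=> xL xx'; rewrite LS; apply/flatten_mapP; exists x.
exists z => // _ [F [FP Flt ->]].
(* For the induction on the number of open blocks, the start is any time [n] before the first set,
   with an empty current block. *)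
suff PS_state m' n a (F' : 'I_m' -> {fset nat}) :
    (m', a, 0%N) \in L n -> (forall i, Pf (F' i)) ->
    (forall i j : 'I_m', j = i.+1 :> nat ->
       forall s t : nat, s \in F' i -> t \in F' j -> (s < t)%N) ->
    (forall i : 'I_m', i = 0%N :> nat -> forall t, t \in F' i -> (n < t)%N) ->
    E (a * \prod_(i < m') \sum_(t <- F' i) z t)%N.
  rewrite -[X in E X]mul1n; apply: (PS_state _ 0%N) => //.
    by rewrite L0 inE.
  by move=> i _; apply: (FP i).2.
elim: m' n a F' {F FP Flt Em Gm L0} => [|m' IH] n a F aL FP Flt nF.
  by rewrite big_ord0 muln1; apply: (LG _ _ aL).
have [k kF0 kmax] := fset_nat_max (FP ord0).1.
have nk : (n < k)%N by apply: nF kF0.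
have sumL d : (m'.+1, a, \sum_(n.+1 <= t < (n + d).+1 | t \in F ord0) z t)%N
    \in L (n + d)%N.
  elim: d => [|d IHd]; first by rewrite addn0 big_geq.
  rewrite addnS; apply: Lstep IHd _.
  rewrite big_mkcond big_nat_recr /= -?big_mkcond; last first.
    by rewrite ltnS leq_addr.
  by case: ifP => _; rewrite ?addn0 !inE eqxx ?orbT.
(* The block stays open through time [k.-1]; the step at [k], the maximum of the set, adds [z k] and
   closes it. *)
have := sumL (k.-1 - n)%N; rewrite subnKC; last by rewrite -ltnS (ltn_predK nk).
rewrite (ltn_predK nk) => /Lstep; rewrite (ltn_predK nk).
move=> /(_ (m', a * (\sum_(n.+1 <= t < k | t \in F ord0) z t + z k), 0)%N).
rewrite !inE eqxx !orbT => /(_ isT).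
have -> : (\sum_(n.+1 <= t < k | t \in F ord0) z t + z k =
    \sum_(t <- F ord0) z t)%N.
  transitivity (\sum_(n.+1 <= t < k.+1 | t \in F ord0) z t)%N.
    by rewrite [RHS]big_mkcond big_nat_recr //= kF0 -big_mkcond.
  rewrite -big_filter; apply: perm_big; apply: uniq_perm.
  - by rewrite filter_uniq // iota_uniq.
  - exact: fset_uniq.
  move=> t; rewrite mem_filter mem_index_iota ltnS.
  by case: (boolP (t \in F ord0)) => // tF; rewrite (nF ord0) // kmax.
move=> aL'; rewrite big_ord_recl mulnA; apply: IH aL' _ _ _.
- by move=> i; apply: FP.
- by move=> i j ij; apply: Flt; rewrite /= /bump /= ij.
- by move=> i i0 t; apply: Flt kF0; rewrite /= /bump /= i0.
Qed.

Theorem theorem3p17 (r m : nat) (hr : (0 < r)%N) (hm : (0 < m)%N)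
    (E : 'I_r -> set nat) (hE : Npos = \bigcup_(k : 'I_r) E k)
    (u v : 'I_m -> nat)
    (hu : forall i : 'I_m, (0 < u i)%N) (hv : forall i : 'I_m, (0 < v i)%N)
    (A : forall i : 'I_m, 'M[rat]_(u i, v i))
    (hA : forall i : 'I_m, image_partition_regular (A i)) :
  exists (k : 'I_r) (x y : forall i : 'I_m, 'cV[nat]_(v i)) (z : nat -> nat),
    (forall i : 'I_m, vec_in Npos (x i)) /\
    (forall i : 'I_m, vec_in Npos (y i)) /\
    (forall t : nat, Npos t -> Npos (z t)) /\
    (forall i : 'I_m, vec_in (inQ (E k)) (A i *m ratv (x i))) /\
    (forall i : 'I_m, vec_in (inQ Npos) (A i *m ratv (y i))) /\
    prod_set (fun i : 'I_m => A i *m ratv (y i)) `<=` inQ (E k) /\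
    PS m z `<=` E k.
Proof.
have [p [pU pN pA pp]] := exists_rich_idempotent hu hA.
have [k Ek] : exists k, in_power p (E k) m 1.
  by apply: in_power_cover => //; rewrite hE.
have xP i : exists x : 'cV[nat]_(v i),
    vec_in Npos x /\ vec_in (inQ (E k)) (A i *m ratv x).
  have Ek' : in_power p (E k) m.-1.+1 1 by rewrite prednK.
  have [x [w [xN Ax wE]]] := in_power_rich _ pN (pA i) (isT : Npos 1%N) Ek'.
  by exists x; split=> // j; rewrite Ax mxE; exists (w j 0).
have {}xP i := cid (xP i).
have [y [w [yN wN Ay wE]]] := in_power_images _ pN pA Ek.
have [z zN zE] := in_power_PS _ pN pp Ek.
exists k, (fun i => sval (xP i)), y, z; do !split=> //.
- by move=> i; apply: (svalP (xP i)).1.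
- by move=> i; apply: (svalP (xP i)).2.
- by move=> i j; rewrite Ay mxE; exists (w i j 0) => //; apply: wN.
- move=> _ [j ->]; exists (\prod_(i < m) w i (j i) 0%R)%N; first exact: wE.
  by rewrite natr_prod; apply: eq_bigr => i _; rewrite Ay mxE.
Qed.
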